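(* Let $\bar\gamma_{\mathrm{R}},\bar\gamma_{\mathrm{D}},\bar\gamma_{\mathrm{E}}>0$ and $\mathcal{R}>0$. Let $h_{\mathrm{S},\mathrm{R}},h_{\mathrm{R},\mathrm{D}},h_{\mathrm{S},\mathrm{E}}$ be independent $\mathcal{CN}(0,1)$ random variables. Define $$\mathcal{R}^{2}_{\mathrm{S}\to\mathrm{R}}=\log_2\frac{1+\bar\gamma_{\mathrm{R}}|h_{\mathrm{S},\mathrm{R}}|^2}{1+\bar\gamma_{\mathrm{E}}|h_{\mathrm{S},\mathrm{E}}|^2},\qquad \mathcal{R}^{2}_{\mathrm{R}\to\mathrm{D}}=\log_2\left(1+\bar\gamma_{\mathrm{D}}|h_{\mathrm{R},\mathrm{D}}|^2\right),$$ $\mathcal{R}_2=\max\{\min\{\mathcal{R}^{2}_{\mathrm{S}\to\mathrm{R}},\mathcal{R}^{2}_{\mathrm{R}\to\mathrm{D}}\},0\}$ and $\mathcal{P}_2=\Pr(\mathcal{R}_2<\mathcal{R})$. Then $$\mathcal{P}_2=1-\mathrm{e}^{-\frac{2^{\mathcal{R}}-1}{\bar\gamma_{\mathrm{D}}}-\frac{2^{\mathcal{R}}-1}{\bar\gamma_{\mathrm{R}}}}\cdot\frac{1}{1+\frac{2^{\mathcal{R}}}{\bar\gamma_{\mathrm{R}}}\bar\gamma_{\mathrm{E}}}.$$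
   Context: This models a decode-and-forward relay system (source S, relay R, destination D, eavesdropper E) where the eavesdropper overhears only the source's transmission. $\mathcal{CN}(0,1)$ denotes a circularly symmetric complex Gaussian random variable with zero mean and unit variance (Rayleigh fading). $\bar\gamma$'s are average SNRs, $\mathcal{R}_2$ the secrecy capacity and $\mathcal{P}_2$ the secrecy outage probability. *)

(* Defs.v *)
From HB Require Import structures.
From mathcomp Require Import all_boot all_order all_algebra.
From mathcomp Require Import all_classical all_reals all_analysis.
Set Implicit Arguments. Unset Strict Implicit. Unset Printing Implicit Defensive.
Import Order.TTheory GRing.Theory Num.Theory.
Import numFieldNormedType.Exports.
Local Open Scope classical_set_scope.
Local Open Scope ring_scope.

(* A complex number z is represented by (Re z, Im z) : R * R. *)

Definition cabs2 {R : realType} (z : R * R) : R := z.1 ^+ 2 + z.2 ^+ 2.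

Definition cn01_density {R : realType} (z : R * R) : R :=
  pi^-1 * expR (- cabs2 z).

Definition leb2 {R : realType} :=
  ((@lebesgue_measure R) \x (@lebesgue_measure R))%E.

Definition is_CN01 {d} {T : measurableType d} {R : realType}
  (P : probability T R) (h : T -> R * R) : Prop :=
  measurable_fun setT h /\
  forall A : set (R * R), measurable A ->
    P (h @^-1` A) = (\int[leb2]_(z in A) (cn01_density z)%:E)%E.

Definition indep3 {d} {T : measurableType d} {R : realType}
  (P : probability T R) (h1 h2 h3 : T -> R * R) : Prop :=
  forall A1 A2 A3 : set (R * R), measurable A1 -> measurable A2 -> measurable A3 ->
    P (h1 @^-1` A1 `&` h2 @^-1` A2 `&` h3 @^-1` A3) =
    (P (h1 @^-1` A1) * P (h2 @^-1` A2) * P (h3 @^-1` A3))%E.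

Definition log2 {R : realType} (x : R) : R := ln x / ln 2.

Definition R2 {R : realType} (gR gD gE : R) (hSR hRD hSE : R * R) : R :=
  Num.max (Num.min (log2 ((1 + gR * cabs2 hSR) / (1 + gE * cabs2 hSE)))
                   (log2 (1 + gD * cabs2 hRD))) 0.

(* Main.v *)
(* Writing X, Y, Z for the squared moduli of h_{S,R}, h_{R,D}, h_{S,E}, the
   event R_2 >= Rs is { Y >= c } and { X >= a + b Z } with c = (2^Rs - 1)/gD,
   a = (2^Rs - 1)/gR and b = 2^Rs gE/gR.  If X, Y, Z are independent Exp(1)
   variables, its probability is e^{-c} E[e^{-(a + b Z)}] = e^{-c-a}/(1 + b).

   That |h|^2 is exponential is obtained without polar coordinates: by scaling,
   the disc |z|^2 <= t has area v t, so |z|^2 pushes planar Lebesgue measure to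
   v times linear Lebesgue measure on [0, +oo[.  Hence |h|^2 has density
   (v/pi) e^{-s}, and total mass 1 forces v = pi. *)

Require Import Defs.
From HB Require Import structures.
From mathcomp Require Import all_boot all_order all_algebra.
From mathcomp Require Import all_classical all_reals all_analysis.
From mathcomp Require Import measurable_realfun ring lra.
Set Implicit Arguments.
Unset Strict Implicit.
Unset Printing Implicit Defensive.
Import Order.TTheory GRing.Theory Num.Theory.
Import numFieldNormedType.Exports.
Local Open Scope classical_set_scope.
Local Open Scope ring_scope.

(* The library's measure structure on [pushforward m f] depends on the proof
   [mf], so it cannot be inferred; this packs it explicitly. *)
Definition image_measure d d' (T : measurableType d) (T' : measurableType d')
    (R : realType) (m : {measure set T -> \bar R}) (f : T -> T')
    (mf : measurable_fun setT f) : {measure set T' -> \bar R} :=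
  measure_function_pushforward__canonical__measure_function_Measure m mf.

(** * Lebesgue measure under dilation, and areas of discs *)

Lemma lebesgue_measure_scale (R : realType) (c : R) (A : set R) :
  0 < c -> measurable A ->
  (lebesgue_measure A = c%:E * lebesgue_measure ((fun x => c * x)%R @^-1` A))%E.
Proof.
move=> c0 mA; pose f : measurableTypeR R -> measurableTypeR R := fun x => c * x.
have mf : measurable_fun setT f by exact: measurable_funM.
(* [m] is [c] times the image of Lebesgue measure under dilation by [c]; uniqueness reduces the
   claim to half-open intervals. *)
pose m : {measure set (measurableTypeR R) -> \bar R} :=
  mscale (NngNum (ltW c0)) (image_measure (@lebesgue_measure R) mf).
apply: (@lebesgue_measure_unique R m) => // _ [[a b] _ <-].
rewrite [RHS](_ : _ = c%:E * lebesgue_measure (f @^-1` `]a, b]))%E//.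
rewrite (_ : f @^-1` _ = `](a / c), (b / c)]%classic); last first.
  by apply/seteqP; split=> x /=;
    rewrite !in_itv/= ltr_pdivrMr// ler_pdivlMr// mulrC.
rewrite !lebesgue_measure_itv/= !lte_fin ltr_pM2r ?invr_gt0//.
case: ifPn => _; last by rewrite mule0.
by rewrite -EFinB -EFinM -mulrBl mulrCA divff ?mulr1 ?gt_eqF.
Qed.

Lemma measurable_cabs2 (R : realType) : measurable_fun [set: R * R] (@cabs2 R).
Proof.
by apply: measurable_funD; apply: measurable_funX;
  [exact: measurable_fst|exact: measurable_snd].
Qed.

(** A product measure is determined by its values on rectangles, where each side contributes one
    factor [c]. *)
Lemma leb2_scale (R : realType) (c : R) (A : set (R * R)) :
  0 < c -> measurable A ->
  (leb2 A = (c ^+ 2)%:E * leb2 ((fun z => (c * z.1, c * z.2))%R @^-1` A))%E.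
Proof.
move=> c0 mA; pose T := measurableTypeR R.
pose f : T * T -> T * T := fun z => (c * z.1, c * z.2).
have mf : measurable_fun setT f.
  by apply: measurable_fun_pair; apply: measurable_funM.
pose m : {measure set (T * T) -> \bar R} :=
  mscale (NngNum (exprn_ge0 2 (ltW c0))) (image_measure (@leb2 R) mf).
rewrite /leb2.
apply: (@product_measure_unique _ _ _ _ _ _ _ m) => // {A mA} A B mA mB.
rewrite [LHS](_ : _ = (c ^+ 2)%:E * leb2 (f @^-1` (A `*` B)))%E//.
rewrite (_ : f @^-1` (A `*` B) =
  ((fun x => c * x) @^-1` A) `*` ((fun x => c * x) @^-1` B))//.
have mc : measurable_fun setT (fun x : R => c * x) by exact: measurable_funM.
rewrite [X in (_ * X)%E]product_measure1E; last 2 first.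
  by rewrite -[X in measurable X]setTI; exact: mc.
  by rewrite -[X in measurable X]setTI; exact: mc.
rewrite /= (lebesgue_measure_scale c0 mA) (lebesgue_measure_scale c0 mB).
by rewrite expr2 EFinM muleACA.
Qed.

(** Dilation by [Num.sqrt t] carries the unit disc onto this one. *)
Lemma leb2_disc (R : realType) (t : R) : 0 < t ->
  (leb2 [set z : R * R | (cabs2 z <= t)%R] =
   t%:E * leb2 [set z : R * R | (cabs2 z <= 1)%R])%E.
Proof.
move=> t0; have s0 : 0 < Num.sqrt t by rewrite sqrtr_gt0.
rewrite (@leb2_scale R (Num.sqrt t))//; last first.
  rewrite -[X in measurable X]setTI -preimage_itvNyc.
  exact: measurable_cabs2.
rewrite sqr_sqrtr ?(ltW t0)//; congr (_ * leb2 _)%E.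
by apply/seteqP; split => z /=; rewrite /cabs2/= !exprMn sqr_sqrtr ?(ltW t0)//
  -mulrDr -ler_pdivlMl// mulVf ?gt_eqF.
Qed.

(** The disc lies between the squares over [[0, 1/2]] and [[-1, 1]], which bounds its area away from
    0 and infinity. *)
Lemma leb2_disc1_fin (R : realType) : exists2 v : R, 0 < v &
  leb2 [set z : R * R | (cabs2 z <= 1)%R] = v%:E.
Proof.
have mD : measurable [set z : R * R | (cabs2 z <= 1)%R].
  rewrite -[X in measurable X]setTI -preimage_itvNyc.
  exact: measurable_cabs2.
have sq (a b : R) : a < b ->
    leb2 (`[a, b] `*` `[a, b] : set (R * R)) = ((b - a) ^+ 2)%:E.
  move=> ab; rewrite /leb2 product_measure1E//= lebesgue_measure_itv/=.
  by rewrite lte_fin ab expr2 EFinM EFinB.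
have le2 : (leb2 [set z : R * R | (cabs2 z <= 1)%R] <=
            leb2 (`[(-1)%R, 1%R] `*` `[(-1)%R, 1%R] : set (R * R)))%E.
  apply: le_measure; rewrite ?inE//; first exact: measurableX.
  move=> -[x y] /=; rewrite /cabs2/= !in_itv/= => xy; nra.
have ge2 : (leb2 (`[0%R, 2^-1%R] `*` `[0%R, 2^-1%R] : set (R * R)) <=
            leb2 [set z : R * R | (cabs2 z <= 1)%R])%E.
  apply: le_measure; rewrite ?inE//; first exact: measurableX.
  move=> -[x y] /=; rewrite /cabs2/= !in_itv/= => xy; nra.
move: le2 ge2; rewrite !sq//; [|by lra..].
case: (leb2 _) => [v| |]//=; rewrite !lee_fin => _ v0.
by exists v => //; apply: lt_le_trans v0; rewrite exprn_gt0//; lra.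
Qed.

(** For [t <= 0] the set is contained in the origin, which is null. *)
Lemma leb2_disc_max (R : realType) : exists2 v : R, 0 < v &
  forall t : R, leb2 [set z : R * R | (cabs2 z <= t)%R] = (Num.max t 0 * v)%:E.
Proof.
have [v v0 vE] := leb2_disc1_fin R; exists v => // t.
have [t0|t0] := ltP 0 t; first by rewrite leb2_disc// vE.
rewrite mul0r; apply/eqP; rewrite -measure_le0.
apply: (@le_trans _ _ (leb2 ([set 0%R] `*` [set 0%R] : set (R * R)))).
  apply: le_measure; rewrite ?inE.
  - rewrite -[X in measurable X]setTI -preimage_itvNyc.
    exact: measurable_cabs2.
  - exact: measurableX.
  - by move=> -[x y] /=; rewrite /cabs2/= => xy; split=> /=; nra.
by rewrite /leb2 product_measure1E//= lebesgue_measure_set1 mul0e.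
Qed.

(** * The image of planar Lebesgue measure under the squared modulus *)

Lemma leb2_preimage_cabs2 (R : realType) : exists2 v : R, 0 < v &
  forall A : set R, measurable A -> A `<=` `[0, +oo[ ->
    (leb2 (@cabs2 R @^-1` A) = v%:E * lebesgue_measure A)%E.
Proof.
have [v v0 vE] := leb2_disc_max R; exists v => // A mA A0.
pose T := measurableTypeR R.
pose f : T * T -> T := @cabs2 R.
have mf : measurable_fun setT f by exact: measurable_cabs2.
have mN : measurable (`]-oo, 0[%classic : set T) by [].
have vV : 0 <= v^-1 by rewrite invr_ge0 ltW.
pose nu := image_measure (@leb2 R) mf.
(* On the negative half-line [m] is Lebesgue measure itself, so that
   [lebesgue_measure_unique] applies on the whole line. *)
pose m : {measure set T -> \bar R} :=
  measure_add (mscale (NngNum vV) nu) (mrestr (@lebesgue_measure R) mN).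
have mE B : m B = (v^-1%:E * nu B + lebesgue_measure (B `&` `]-oo, 0%R[))%E.
  exact: measure_addE.
have nuE (t : R) : nu (`]-oo, t]%classic : set T) = (Num.max t 0 * v)%:E.
  by rewrite -vE -preimage_itvNyc.
suff -> : lebesgue_measure A = m A.
  rewrite mE (_ : A `&` _ = set0) ?measure0 ?adde0; last first.
    apply/seteqP; split=> // x [/A0 /=]; rewrite !in_itv/= andbT leNgt.
    by move=> /negP.
  by rewrite muleA -EFinM divff ?mul1e// gt_eqF.
apply: (@lebesgue_measure_unique R m) => // _ [[a b] _ <-].
have [ab|ba] := ltP a b; last first.
  by rewrite set_itv_ge ?measure0// bnd_simp -leNgt.
have -> : m (`]a, b]%classic : set T) =
    (v^-1%:E * nu (`]a, b]%classic : set T) +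
     lebesgue_measure (`]a, b] `&` `]-oo, 0%R[))%E by exact: mE.
(* A difference of two half-lines; subtraction is legitimate because discs have finite area. *)
have -> : nu (`]a, b]%classic : set T) = (Num.max b 0 * v - Num.max a 0 * v)%:E.
  have -> : `]a, b]%classic = `]-oo, b] `\` `]-oo, a] :> set R.
    by rewrite -[RHS]setCK setCD setCitvl setUC -[LHS]setCK setCitv.
  rewrite measureD//; last by rewrite [ltLHS]nuE ltry.
  rewrite setIidr; last exact/subset_itvl/ltW.
  by rewrite EFinB -!nuE.
rewrite -EFinM -mulrBl mulrC mulfK ?gt_eqF// lebesgue_measure_itv/= lte_fin ab.
(* The restricted term supplies the negative part of []a, b]]: all of it if [b < 0], otherwise []a,
   0[], which is empty when [0 <= a]. *)
have [b0|b0] := ltP b 0.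
  rewrite (max_r (ltW (lt_trans ab b0))) subr0 add0e setIidl; last first.
    by move=> x /=; rewrite !in_itv/= => /andP[_ /le_lt_trans]; exact.
  by rewrite lebesgue_measure_itv/= lte_fin ab.
rewrite (_ : _ `&` _ = `]a, 0%R[%classic); last first.
  apply/seteqP; split=> x /=; rewrite !in_itv/=; first by move=> [/andP[-> _]].
  by move=> /andP[-> x0]; rewrite (le_trans (ltW x0) b0).
rewrite lebesgue_measure_itv/= lte_fin; have [a0|a0] := ltP a 0.
  by rewrite subr0 add0e.
by rewrite adde0.
Qed.

(** * The squared modulus of a standard complex Gaussian is exponential *)

Lemma cabs2_ge0 (R : realType) (z : R * R) : 0 <= cabs2 z.
Proof. by rewrite addr_ge0// sqr_ge0. Qed.

Lemma integral_exponential_pdf_setI (R : realType) (A : set R) : measurable A ->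
  (\int[lebesgue_measure]_(s in A `&` `[0%R, +oo[) (expR (- s))%:E =
   exponential_prob 1 A :> \bar R)%E.
Proof.
move=> mA; rewrite /exponential_prob integral_mkcondr.
apply: eq_integral => x _; rewrite /exponential_pdf restrict_EFin/=.
by rewrite !patchE; case: ifP => // _; rewrite mul1r mulN1r.
Qed.

Lemma cn01_cabs2_exponential (d : measure_display) (T : measurableType d)
    (R : realType) (P : probability T R) (h : T -> R * R) : is_CN01 P h ->
  forall A : set R, measurable A ->
    P ((fun w => cabs2 (h w)) @^-1` A) = exponential_prob 1 A.
Proof.
move=> [mh hE]; have [v v0 vE] := leb2_preimage_cabs2 R.
have PE (A : set R) : measurable A ->
    P ((fun w => cabs2 (h w)) @^-1` A) =
    ((v / pi)%:E * exponential_prob 1 A)%E.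
  (* Since [cabs2] is nonnegative, cutting [A] down to [[0, +oo[] keeps the event and puts the set
     within reach of [vE]. *)
  move=> mA; pose A' := A `&` `[0, +oo[.
  have mA' : measurable A' by exact: measurableI.
  have mh' : measurable (@cabs2 R @^-1` A').
    by rewrite -[X in measurable X]setTI; exact: measurable_cabs2.
  transitivity (P (h @^-1` (@cabs2 R @^-1` A'))).
    congr (P _); apply/seteqP; split=> w /=; last by case.
    by move=> Aw; split=> //=; rewrite in_itv/= cabs2_ge0.
  rewrite hE//.
  pose U := measurableTypeR R.
  have mf : measurable_fun setT (@cabs2 R : U * U -> U).
    exact: measurable_cabs2.
  have mexp : measurable_fun A' (fun s : R => (pi^-1 * expR (- s))%:E).
    apply: measurable_funTS; apply/measurable_EFinP.
    apply: measurable_funM => //.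
    by apply: measurableT_comp => //; exact: measurable_oppr.
  (* The Gaussian density is a function of [cabs2 z], so its planar integral becomes one against the
     image measure. *)
  have := @ge0_integral_pushforward _ _ _ _ _ _ mf (@leb2 R) A'
    (fun s => (pi^-1 * expR (- s))%:E) mA' mexp.
  move=> /(_ _)/esym ->; last first.
    by move=> s _; rewrite lee_fin mulr_ge0 ?expR_ge0// invr_ge0 pi_ge0.
  rewrite (@eq_measure_integral _ _ _ _
    (mscale (NngNum (ltW v0)) (@lebesgue_measure R))).
    rewrite ge0_integral_mscale//; last first.
      by move=> s _; rewrite lee_fin mulr_ge0 ?expR_ge0// invr_ge0 pi_ge0.
    under eq_integral do rewrite EFinM.
    rewrite ge0_integralZl//.
    - by rewrite integral_exponential_pdf_setI// EFinM muleA.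
    - apply: measurable_funTS; apply/measurable_EFinP.
      by apply: measurableT_comp => //; exact: measurable_oppr.
    - by rewrite lee_fin invr_ge0 pi_ge0.
  move=> B mB BA; apply: vE => //.
  by apply: subset_trans BA _; exact: subIsetr.
(* Both laws have total mass 1, which forces [v / pi = 1]. *)
have /esym := PE setT measurableT.
rewrite preimage_setT probability_setT.
rewrite /exponential_prob integral_exponential_pdf ?mule1 ?ltr01// => -[vpi].
by move=> A mA; rewrite PE// vpi mul1e.
Qed.

Lemma exponential_prob_itvcy (R : realType) (t : R) : 0 <= t ->
  exponential_prob 1 `[t, +oo[ = (expR (- t))%:E.
Proof.
move=> t0; rewrite -integral_exponential_pdf_setI// setIidl; last first.
  by move=> x /=; rewrite !in_itv/= !andbT; exact: le_trans.
(* The last argument [0] is the limit of the primitive at infinity. *)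
rewrite (@ge0_continuous_FTC2y _ _ (fun x => - expR (- x)) _ 0).
- by rewrite -EFinB sub0r opprK.
- by move=> x _; exact: expR_ge0.
- apply: continuous_subspaceT => x.
  by apply: continuous_comp; [exact: opp_continuous|exact: continuous_expR].
- by rewrite -oppr0; apply: cvgN; exact: cvgr_expR.
- by move=> x _; exact: ex_derive.
- apply: cvg_at_right_filter; apply: cvgN.
  by apply: continuous_comp; [exact: opp_continuous|exact: continuous_expR].
- by move=> x _; rewrite derive1E derive_val mulrN1 opprK.
Qed.

(** * Integration against a density, and the mass of an affine half-plane *)

Lemma ge0_integral_density (d : measure_display) (T : measurableType d)
    (R : realType) (nu : {finite_measure set T -> \bar R})
    (mu : {sigma_finite_measure set T -> \bar R}) (g f : T -> \bar R) :
  measurable_fun setT g ->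
  (forall A, measurable A -> nu A = \int[mu]_(x in A) g x)%E ->
  measurable_fun setT f -> (forall x, 0 <= f x)%E ->
  (\int[nu]_x f x = \int[mu]_x (f x * g x))%E.
Proof.
move=> mg nuE mf f0.
have numu : nu `<< mu.
  apply/null_content_dominatesP => A mA muA0; rewrite nuE//.
  by apply: null_set_integral => //; exact: measurable_funTS.
rewrite -(Radon_Nikodym_SigmaFinite.change_of_variables numu)//.
have fint := Radon_Nikodym_SigmaFinite.f_integrable numu.
apply: ae_eq_integral => //.
- by apply: emeasurable_funM => //; exact: measurable_int fint.
- exact: emeasurable_funM.
(* [g] and the Radon-Nikodym derivative both integrate to [nu E] over every measurable [E], so they
   agree almost everywhere. *)
- apply: ae_eqe_mul2l; apply: integral_ae_eq => // E _ mE.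
  by rewrite -nuE// -Radon_Nikodym_SigmaFinite.f_integral.
Qed.

Lemma measurable_affine_le (R : realType) (a b : R) :
  measurable [set p : R * R | a + b * p.1 <= p.2].
Proof.
have mf : measurable_fun setT (fun p : R * R => p.2 - (a + b * p.1)).
  apply: measurable_funB; first exact: measurable_snd.
  by apply: measurable_funD => //; apply: measurable_funM.
have -> : [set p : R * R | a + b * p.1 <= p.2] =
    (fun p => p.2 - (a + b * p.1)) @^-1` `[0, +oo[.
  by rewrite preimage_itvcy; apply/seteqP; split=> p /=; rewrite subr_ge0.
by rewrite -[X in measurable X]setTI; exact: mf.
Qed.

(* The library's measure structure on [exponential_prob] is likewise not
   inferred, hence the arbitrary probabilities agreeing with it. *)
Lemma exponential_product_affine (R : realType)
    (nu1 nu2 : probability (measurableTypeR R) R) (a b : R) :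
  (forall A : set R, measurable A -> nu1 A = exponential_prob 1 A) ->
  (forall A : set R, measurable A -> nu2 A = exponential_prob 1 A) ->
  0 <= a -> 0 <= b ->
  ((nu1 \x nu2) [set p | (a + b * p.1 <= p.2)%R] = (expR (- a) / (1 + b))%:E)%E.
Proof.
move=> nu1E nu2E a0 b0; set S := [set p | _].
have b1 : 0 < 1 + b by rewrite ltr_pwDl.
have mS : measurable S by exact: measurable_affine_le.
rewrite /= /product_measure1.
rewrite (@ge0_integral_density _ _ _ nu1 (@lebesgue_measure R)
  (fun x => (exponential_pdf 1 x)%:E))//; last 2 first.
- by apply/measurable_EFinP; exact: measurable_exponential_pdf.
- exact: measurable_fun_xsection.
(* For [0 <= x] the section has mass [expR (- (a + b * x))]; multiplied by [expR (- x)] this is a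
   constant times the density of rate [1 + b], which integrates to 1. For [x < 0] both sides
   vanish. *)
transitivity (\int[@lebesgue_measure R]_x
    ((expR (- a) / (1 + b))%:E * (exponential_pdf (1 + b) x)%:E))%E.
  apply: eq_integral => x _; have [x0|x0] := ltP x 0.
    by rewrite !lt0_exponential_pdf// !mule0.
  rewrite /=; have -> : xsection S x = `[a + b * x, +oo[%classic.
    apply/seteqP; split=> y; rewrite /xsection/= in_itv/= andbT.
      by rewrite inE.
    by rewrite inE.
  rewrite [X in (X * _ = _)%E](_ : _ = (expR (- (a + b * x)))%:E); last first.
    by rewrite -exponential_prob_itvcy ?addr_ge0 ?mulr_ge0//; exact: nu2E.
  rewrite !exponential_pdfE// -!EFinM; congr EFin.
  rewrite mul1r mulrA divfK ?gt_eqF// -!expRD; congr expR.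
  by ring.
rewrite ge0_integralZl//.
- by rewrite integral_exponential_pdf// mule1.
- by apply/measurable_EFinP; exact: measurable_exponential_pdf.
- by move=> x _; rewrite lee_fin exponential_pdf_ge0// ltW.
- by rewrite lee_fin divr_ge0 ?expR_ge0 ?ltW.
Qed.

(** * The outage event and its probability *)

Lemma le_log2 (R : realType) (r x : R) : 0 < x ->
  (r <= log2 x) = (2 `^ r <= x).
Proof.
move=> x0; rewrite /log2 ler_pdivlMr; last by rewrite ln_gt0 ?ltr1n.
by rewrite -ln_powR ler_ln// posrE powR_gt0.
Qed.

(** As [0 < r], the bound must hold for the minimum, hence for both rates; clearing positive
    denominators makes each condition affine. *)
Lemma le_R2 (R : realType) (gR gD gE r : R) (h1 h2 h3 : R * R) :
  0 < gR -> 0 < gD -> 0 < gE -> 0 < r ->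
  (r <= R2 gR gD gE h1 h2 h3) =
  ((2 `^ r - 1) / gR + 2 `^ r / gR * gE * cabs2 h3 <= cabs2 h1) &&
  ((2 `^ r - 1) / gD <= cabs2 h2).
Proof.
move=> gR0 gD0 gE0 r0.
have D0 (g : R) h : 0 < g -> 0 < 1 + g * cabs2 h.
  by move=> g0; rewrite ltr_pwDl// mulr_ge0 ?cabs2_ge0// ltW.
rewrite /R2 le_max [r <= 0]leNgt r0 orbF le_min.
rewrite !le_log2 ?divr_gt0 ?D0//; congr andb.
  rewrite ler_pdivlMr ?D0// [in RHS](_ : _ + _ =
    (2 `^ r * (1 + gE * cabs2 h3) - 1) / gR); last by field; rewrite gt_eqF.
  by rewrite ler_pdivrMr// lerBlDl [_ * gR]mulrC.
by rewrite ler_pdivrMr// lerBlDl [_ * gD]mulrC.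
Qed.

Theorem theorem4 (d : measure_display) (T : measurableType d) (R : realType)
  (P : probability T R) (hSR hRD hSE : T -> R * R)
  (gR gD gE Rs : R) :
  0 < gR -> 0 < gD -> 0 < gE -> 0 < Rs ->
  is_CN01 P hSR -> is_CN01 P hRD -> is_CN01 P hSE ->
  indep3 P hSR hRD hSE ->
  P [set w | R2 gR gD gE (hSR w) (hRD w) (hSE w) < Rs] =
  (1 - expR (- ((2 `^ Rs - 1) / gD) - (2 `^ Rs - 1) / gR)
       * (1 + (2 `^ Rs / gR) * gE)^-1)%:E.
Proof.
move=> gR0 gD0 gE0 Rs0 cnSR cnRD cnSE ind.
set c := (2 `^ Rs - 1) / gD; set a := (2 `^ Rs - 1) / gR.
set b := 2 `^ Rs / gR * gE.
(* This makes the thresholds [c] and [a] nonnegative, as the exponential tail formula requires. *)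
have pow_ge1 : 1 <= 2 `^ Rs :> R
  by rewrite -[leLHS](powRr0 2) ler_powR ?ler1n ?ltW.
have c0 : 0 <= c by rewrite divr_ge0 ?subr_ge0// ltW.
have a0 : 0 <= a by rewrite divr_ge0 ?subr_ge0// ltW.
have b0 : 0 <= b by rewrite !mulr_ge0 ?invr_ge0 ?powR_ge0 ?ltW.
pose U := measurableTypeR R.
have mcabs2 h : is_CN01 P h -> measurable_fun setT (fun w => cabs2 (h w) : U).
  by move=> [mh _]; apply: measurableT_comp mh; exact: measurable_cabs2.
pose X w : U := cabs2 (hSR w); pose Z w : U := cabs2 (hSE w).
have mX : measurable_fun setT X by exact: mcabs2.
have mZ : measurable_fun setT Z by exact: mcabs2.
pose E := (fun w => cabs2 (hRD w)) @^-1` `[c, +oo[.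
have mE : measurable E.
  by rewrite -[X in measurable X]setTI; exact: (mcabs2 _ cnRD).
have PE : P E = (expR (- c))%:E.
  by rewrite (cn01_cabs2_exponential cnRD)// exponential_prob_itvcy.
have mZX : measurable_fun setT (fun w => (Z w, X w)).
  exact: measurable_fun_pair.
pose X' : {mfun T >-> U} := HB.pack X (isMeasurableFun.Build _ _ _ _ _ mX).
pose Z' : {mfun T >-> U} := HB.pack Z (isMeasurableFun.Build _ _ _ _ _ mZ).
pose nuX : probability U R := distribution P X'.
pose nuZ : probability U R := distribution P Z'.
have nuXE A : measurable A -> nuX A = exponential_prob 1 A.
  exact: cn01_cabs2_exponential.
have nuZE A : measurable A -> nuZ A = exponential_prob 1 A.
  exact: cn01_cabs2_exponential.
(* The joint law of (Z, X) conditioned on [E], as [P E = expR (- c)]. *)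
pose m : {measure set (U * U) -> \bar R} := mscale (NngNum (expR_ge0 c))
  (image_measure (mrestr P mE) mZX).
have mE' (A : set (U * U)) :
    m A = ((expR c)%:E * P ((fun w => (Z w, X w)) @^-1` A `&` E))%E.
  by [].
pose S : set (U * U) := [set p | a + b * p.1 <= p.2].
have -> : [set w | R2 gR gD gE (hSR w) (hRD w) (hSE w) < Rs] =
    ~` ((fun w => (Z w, X w)) @^-1` S `&` E).
  apply/seteqP; split=> w /=; rewrite ltNge le_R2// /E /= in_itv/= andbT.
    by move=> /negP H [H1 H2]; apply: H; rewrite H1.
  by move=> H; apply/negP => /andP[H1 H2]; apply: H.
have mS : measurable S by exact: measurable_affine_le.
rewrite probability_setC; last first.
  apply: measurableI => //; rewrite -[X in measurable X]setTI.
  exact: (mZX measurableT S).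
have -> : P ((fun w => (Z w, X w)) @^-1` S `&` E) =
    (expR (- c) * (expR (- a) / (1 + b)))%:E.
  rewrite EFinM -(exponential_product_affine nuZE nuXE)//.
  (* [m] is identified with the product law by checking rectangles, so [P] of the event is
     [expR (- c)] times [m S]. *)
  rewrite (@product_measure_unique _ _ _ _ _ nuZ nuX m)//.
    by rewrite mE' muleA -EFinM -expRD addNr expR0 mul1e.
  move=> A B mA mB; rewrite mE'.
  have mc (B' : set R) : measurable B' -> measurable (@cabs2 R @^-1` B').
    by rewrite -[X in _ -> measurable X]setTI; exact: measurable_cabs2.
  (* Independence gives the rectangle identity; its factor [P E] cancels against the normalisation
     [expR c]. *)
  have := ind _ _ _ (mc _ mB) (mc _ (measurable_itv `[c, +oo[)) (mc _ mA).
  rewrite [P (hRD @^-1` _)]PE setIAC => indE.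
  rewrite (_ : _ `&` E = hSR @^-1` (@cabs2 R @^-1` B) `&`
    hSE @^-1` (@cabs2 R @^-1` A) `&` hRD @^-1` (@cabs2 R @^-1` `[c, +oo[)).
    rewrite indE muleAC muleCA -EFinM -expRD subrr.
    by rewrite expR0 mule1 muleC.
  by apply/seteqP; split=> w /= [[? ?] ?].
by rewrite mulrA -expRD EFinB.
Qed.
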